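(* Let $X$ be a complex Banach space and let $T\in L(X)$ be a B-Fredholm operator. Let $S\in L(X)$ be a Drazin inverse of $T$ modulo the ideal $F_0(X)$ of finite rank operators, i.e. $\pi(S)$ is the Drazin inverse of $\pi(T)$ in $L(X)/F_0(X)$, where $\pi:L(X)\to L(X)/F_0(X)$ is the canonical projection. Then $TS-ST$ is a finite rank operator and $$\operatorname{ind}(T)=\tau(TS-ST),$$ where $\operatorname{ind}(T)$ is the usual index of the B-Fredholm operator $T$ and $\tau$ is the trace of finite rank operators.
   Context: $L(X)$ denotes the algebra of bounded linear operators on $X$. An operator $T\in L(X)$ is B-Fredholm if there is $n\in\mathbb{N}$ such that the range $R(T^n)$ is closed and the restriction $T_n:R(T^n)\to R(T^n)$ of $T$ is a Fredholm operator; then $T_m$ is Fredholm with the same index for all $m\ge n$, and the index of $T$ is defined as $\operatorname{ind}(T)=\operatorname{ind}(T_n)$ (the usual Fredholm index $\dim\ker-\operatorname{codim}$ range). An element $x$ of an algebra $B$ is Drazin invertible if there exist $y\in B$ and $k\ge1$ with $xy=yx$, $yxy=y$, $x^kyx=x^k$; $y$ is then unique and called the Drazin inverse of $x$. For a finite rank operator $F$ written as $F(x)=\sum_{i=1}^n x_i'(x)x_i$ with $x_1,\dots,x_n$ a basis of $R(F)$ and $x_1',\dots,x_n'$ continuous linear functionals on $X$, its trace is $\tau(F)=\sum_{i=1}^n x_i'(x_i)$. *)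

(* Defs.v *)
From HB Require Import structures.
From mathcomp Require Import all_boot all_order all_algebra.
From mathcomp Require Import complex.
From mathcomp Require Import all_classical all_reals all_analysis.
Set Implicit Arguments. Unset Strict Implicit. Unset Printing Implicit Defensive.
Import Order.TTheory GRing.Theory Num.Theory ComplexField.
Import numFieldTopology.Exports numFieldNormedType.Exports.
Local Open Scope classical_set_scope.
Local Open Scope ring_scope.

Section BFredholm.
Variables (R : realType) (X : completeNormedModType R[i]).

Definition linear_op (f : X -> X) :=
  forall (a : R[i]) (x y : X), f (a *: x + y) = a *: f x + f y.
Definition bounded_op (f : X -> X) :=
  linear_op f /\ exists M : R[i], forall x, `|f x| <= M * `|x|.

Definition cont_functional (phi : X -> R[i]) :=
  (forall (a : R[i]) (x y : X), phi (a *: x + y) = a * phi x + phi y)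
  /\ continuous (phi : X -> R[i]^o).

Definition lin_comb n (c : 'I_n -> R[i]) (v : 'I_n -> X) : X :=
  \sum_(i < n) c i *: v i.

Definition lin_indep n (v : 'I_n -> X) :=
  forall c : 'I_n -> R[i], lin_comb c v = 0 -> forall i, c i = 0.

Definition has_dim (V : set X) (n : nat) :=
  exists v : 'I_n -> X, (forall i, V (v i)) /\ lin_indep v /\
    (forall x, V x -> exists c, x = lin_comb c v).

(* W subspace of V has codimension n in V: dim (V / W) = n, i.e. there are
   v_1..v_n in V whose classes form a basis of V/W *)
Definition has_codim (V W : set X) (n : nat) :=
  exists v : 'I_n -> X, (forall i, V (v i)) /\
    (forall c, W (lin_comb c v) -> forall i, c i = 0) /\
    (forall x, V x -> exists c w, W w /\ x = w + lin_comb c v).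

Definition rangeP (T : X -> X) (n : nat) : set X := range (iter n T).

(* T_n : R(T^n) -> R(T^n) is Fredholm with index i, and R(T^n) is closed *)
Definition BFredholm_at (T : X -> X) (n : nat) (i : int) :=
  closed (rangeP T n) /\
  exists a b : nat,
    has_dim [set x | rangeP T n x /\ T x = 0] a /\
    closed (T @` rangeP T n) /\
    has_codim (rangeP T n) (T @` rangeP T n) b /\
    i = (a%:Z - b%:Z)%R.

Definition BFredholm (T : X -> X) := exists n i, BFredholm_at T n i.

Definition ind (T : X -> X) : int :=
  match pselect (exists i, exists n, BFredholm_at T n i) with
  | left H => projT1 (cid H)
  | right _ => 0
  end.

Definition finite_rank (F : X -> X) :=
  exists n (v : 'I_n -> X), forall x, exists c, F x = lin_comb c v.

Definition trace_rep (F : X -> X) (t : R[i]) :=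
  exists n (v : 'I_n -> X) (phi : 'I_n -> X -> R[i]),
    has_dim (range F) n /\ (forall i, range F (v i)) /\ lin_indep v /\
    (forall i, cont_functional (phi i)) /\
    (forall x, F x = \sum_(i < n) phi i x *: v i) /\
    t = \sum_(i < n) phi i (v i).

Definition trace (F : X -> X) : R[i] :=
  match pselect (exists t, trace_rep F t) with
  | left H => projT1 (cid H)
  | right _ => 0
  end.

Definition drazin_mod_finrank (T S : X -> X) :=
  finite_rank (fun x => T (S x) - S (T x)) /\
  finite_rank (fun x => S (T (S x)) - S x) /\
  exists k : nat, (1 <= k)%N /\
    finite_rank (fun x => iter k T (S (T x)) - iter k T x).

End BFredholm.

(* Main.v *)
Require Import Defs.
From HB Require Import structures.
From mathcomp Require Import all_boot all_order all_algebra.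
From mathcomp Require Import complex.
From mathcomp Require Import all_classical all_reals all_analysis.
Import Order.TTheory GRing.Theory Num.Theory ComplexField.
Import numFieldTopology.Exports numFieldNormedType.Exports.
Local Open Scope ring_scope.

Set Implicit Arguments. Unset Strict Implicit. Unset Printing Implicit Defensive.

(* Everything except the continuity of coordinate functionals is linear algebra.
   Let Y be the range of T^n, j : Y -> X the inclusion, p : X -> Y the
   corestriction of T^n and A the restriction of T to Y.  Modulo finite rank,
   S = T^n S^(2n+1) T^n = j W p with W = p S^(2n+1) j, so by cyclicity of the
   trace tr [T, S] = tr (j [A, W] p) = tr (p j [A, W]) = tr [A, U] with
   U = A^n W.  The Drazin identities make 1 - A U of finite rank, and a
   finite-rank correction U' of U makes 1 - A U' and 1 - U' A projections onto a
   complement of the range and onto the kernel of A, whence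
   tr [A, U] = dim ker A - codim ran A. *)

(** * Linear maps packed from functions, and their iterates *)

Section LinearMaps.
Variables (K : fieldType) (U : lmodType K).

Definition scalar_of (f : U -> K) (fL : scalar f) : {scalar U} :=
  HB.pack f (GRing.isLinear.Build K U K *%R f fL).

Definition linear_of (V : lmodType K) (f : U -> V) (fL : linear f) :
  {linear U -> V} := HB.pack f (GRing.isLinear.Build K U V *:%R f fL).

Lemma iter_linear (f : {linear U -> U}) n : linear (iter n f).
Proof. by elim: n => [|n IHn] a x y //=; rewrite IHn linearP. Qed.

HB.instance Definition _ (f : {linear U -> U}) n :=
  GRing.isLinear.Build K U U *:%R (iter n f) (iter_linear f n).

End LinearMaps.

(** * Maps of finite rank and coordinates modulo a subspace *)

Section FiniteRank.
Variable K : fieldType.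

Definition fin_rank (U : Type) (V : lmodType K) (F : U -> V) :=
  exists n (v : 'I_n -> V), forall x, exists c : 'I_n -> K,
    F x = \sum_(i < n) c i *: v i.

Lemma fin_rank_ext (U : Type) (V : lmodType K) (F G : U -> V) :
  F =1 G -> fin_rank F -> fin_rank G.
Proof. by move=> FG [n [v Fv]]; exists n, v => x; rewrite -FG. Qed.

Lemma fin_rankD (U : Type) (V : lmodType K) (F G : U -> V) :
  fin_rank F -> fin_rank G -> fin_rank (fun x => F x + G x).
Proof.
move=> [n [v Fv]] [m [w Gw]].
exists (n + m)%N, (fun i => match fintype.split i with inl i => v i | inr i => w i end) => x.
have [c ->] := Fv x; have [d ->] := Gw x.
exists (fun i => match fintype.split i with inl i => c i | inr i => d i end).
rewrite big_split_ord; congr (_ + _); apply: eq_bigr => i _.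
  by rewrite (unsplitK (inl i)).
by rewrite (unsplitK (inr i)).
Qed.

Lemma fin_rank_compl (U : Type) (V W : lmodType K) (B : {linear V -> W})
    (F : U -> V) :
  fin_rank F -> fin_rank (fun x => B (F x)).
Proof.
move=> [n [v Fv]]; exists n, (B \o v) => x; have [c ->] := Fv x.
by exists c; rewrite linear_sum; apply: eq_bigr => i _; rewrite linearZ.
Qed.

Lemma fin_rank_compr (U U' : Type) (V : lmodType K) (F : U -> V) (g : U' -> U) :
  fin_rank F -> fin_rank (fun x => F (g x)).
Proof. by move=> [n [v Fv]]; exists n, v => x. Qed.

Lemma fin_rankN (U : Type) (V : lmodType K) (F : U -> V) :
  fin_rank F -> fin_rank (fun x => - F x).
Proof.
move=> [n [v Fv]]; exists n, v => x; have [c ->] := Fv x.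
by exists (fun i => - c i); rewrite -sumrN; apply: eq_bigr => i _; rewrite scaleNr.
Qed.

Lemma fin_rankB (U : Type) (V : lmodType K) (F G : U -> V) :
  fin_rank F -> fin_rank G -> fin_rank (fun x => F x - G x).
Proof. by move=> Ff Gf; apply: (fin_rankD Ff); apply: fin_rankN. Qed.

Section Coordinates.
Variables (U V : lmodType K) (f : {linear U -> V}) (W : V -> Prop).
Variables (n : nat) (v : 'I_n -> V).
Hypothesis WP : forall a x y, W x -> W y -> W (a *: x + y).
Hypothesis v_free : forall c : 'I_n -> K, W (\sum_i c i *: v i) -> forall i, c i = 0.
Hypothesis v_span : forall x, exists c : 'I_n -> K, W (f x - \sum_i c i *: v i).

Lemma coordinates : exists phi : 'I_n -> {scalar U},
  (forall x, W (f x - \sum_i phi i x *: v i)) /\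
  (forall x (c : 'I_n -> K), W (f x - \sum_i c i *: v i) -> forall i, c i = phi i x).
Proof.
have [c Wc] := choice v_span.
have uniq_c x d : W (f x - \sum_i d i *: v i) -> forall i, d i = c x i.
  move=> Wd i; apply/eqP; rewrite -subr_eq0; apply/eqP; rewrite -opprB.
  apply/eqP; rewrite oppr_eq0; apply/eqP.
  apply: (v_free (c := fun i => c x i - d i)).
  have := WP (-1) (Wc x) Wd; congr W.
  rewrite scaleN1r opprB addrA subrK.
  by rewrite -sumrB; apply: eq_bigr => k _; rewrite scalerBl.
have c_scalar i : scalar (fun x => c x i).
  move=> a x y; apply/esym; apply: (uniq_c _ (fun i => a * c x i + c y i)).
  have := WP a (Wc x) (Wc y); congr W.
  rewrite linearP scalerBr scaler_sumr addrACA -opprD -big_split /=.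
  by congr (_ - _); apply: eq_bigr => k _; rewrite scalerDl scalerA.
by exists (fun i => scalar_of (c_scalar i)); split.
Qed.

End Coordinates.

(* A dependence between more than [n] vectors in the span of [n] vectors is a
   nonzero row of the kernel of the coefficient matrix. *)
Lemma free_in_span_leq (V : lmodType K) n (v : 'I_n -> V) m (w : 'I_m -> V) :
  (forall i, exists c : 'I_n -> K, w i = \sum_j c j *: v j) ->
  (forall c : 'I_m -> K, \sum_i c i *: w i = 0 -> forall i, c i = 0) ->
  (m <= n)%N.
Proof.
move=> /choice[c wE] w_free; rewrite leqNgt; apply/negP => ltnm.
pose A := \matrix_(i < m, j < n) c i j.
have /eqP := mxrank_ker A; rewrite eqn_leq => /andP[_ rk].
have /rowV0Pn[u] : kermx A != 0.
  rewrite -mxrank_eq0 -lt0n (leq_trans _ rk) // subn_gt0.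
  exact: leq_ltn_trans (rank_leq_col A) ltnm.
move=> /sub_kermxP uA /negP; apply; apply/eqP/rowP => i; rewrite mxE.
apply: (w_free (fun i => u 0 i)).
under eq_bigr do rewrite wE scaler_sumr.
rewrite exchange_big big1 // => j _.
under eq_bigr do rewrite scalerA.
rewrite -scaler_suml [X in X *: _](_ : _ = (u *m A) 0 j).
  by rewrite uA mxE scale0r.
by rewrite mxE; apply: eq_bigr => k _; rewrite mxE.
Qed.

(* The vectors of the representation are obtained from a maximal independent
   family in the range of [F]. *)
Lemma fin_rank_basis (U V : lmodType K) (F : {linear U -> V}) :
  fin_rank F -> exists n (z : 'I_n -> U) (phi : 'I_n -> {scalar U}),
    (forall c : 'I_n -> K, \sum_i c i *: F (z i) = 0 -> forall i, c i = 0) /\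
    (forall x, F x = \sum_i phi i x *: F (z i)).
Proof.
move=> [N [v Fv]].
pose free_range m := exists z : 'I_m -> U,
  forall c : 'I_m -> K, \sum_i c i *: F (z i) = 0 -> forall i, c i = 0.
have ex0 : exists m, `[< free_range m >].
  by exists 0%N; apply/asboolP; exists (fun _ => 0) => c _ [].
have leN m : `[< free_range m >] -> (m <= N)%N.
  move=> /asboolP[z z_free]; apply: (free_in_span_leq (v := v)) z_free => i.
  exact: Fv.
case: (ex_maxnP ex0 leN) => m /asboolP[z z_free] m_max.
have z_span x : exists c : 'I_m -> K, F x - \sum_i c i *: F (z i) = 0.
  apply: contrapT => x_out.
  suff /asboolP/m_max : free_range m.+1 by rewrite ltnn.
  exists (fun i => if unlift ord0 i is Some k then z k else x) => c.
  rewrite big_ord_recl unlift_none.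
  under eq_bigr do rewrite liftK.
  move=> sum0; have c0 : c ord0 = 0.
    apply/eqP/negP => /negP c_neq0; apply: x_out.
    exists (fun i => - (c ord0)^-1 * c (lift ord0 i)).
    under eq_bigr do rewrite -scalerA.
    rewrite -scaler_sumr scaleNr opprK.
    rewrite -[F x]scale1r -(mulVf c_neq0) -scalerA -scalerDr.
    by rewrite sum0 scaler0.
  move: sum0; rewrite c0 scale0r add0r => /z_free cz i.
  by case: (unliftP ord0 i) => [k ->|->].
have [|//|//|phi [phiE _]] := @coordinates _ _ F (fun y => y = 0) m (F \o z).
  by move=> a x y -> ->; rewrite scaler0 addr0.
exists m, z, phi; split=> // x; apply/eqP; rewrite -subr_eq0; apply/eqP.
exact: phiE.
Qed.

(** [T (F x)] is a combination of finitely many [T (F (z i))]. Subtracting the same combination of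
    the [F (z i)] from [F x] leaves a vector of the kernel of [T], which [w] spans. *)
Lemma fin_rank_cancel (U V W : lmodType K) (T : {linear V -> W})
    (F : {linear U -> V}) a (w : 'I_a -> V) :
  (forall i, T (w i) = 0) ->
  (forall x, T x = 0 -> exists c : 'I_a -> K, x = \sum_i c i *: w i) ->
  fin_rank (fun x => T (F x)) -> fin_rank F.
Proof.
move=> Tw ker_w /(@fin_rank_basis _ _ (T \o F)) [n [z [phi [_ TF]]]].
pose G x := \sum_i phi i x *: F (z i).
apply: (@fin_rank_ext _ _ (fun x => G x + (F x - G x))).
  by move=> x; rewrite addrC subrK.
apply: fin_rankD; first by exists n, (F \o z) => x; exists (phi ^~ x).
exists a, w => x; apply: ker_w.
rewrite linearB linear_sum [T (F x)]TF.
by apply/eqP; rewrite subr_eq0; apply/eqP/eq_bigr => i _; rewrite linearZ.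
Qed.

End FiniteRank.

(** * The algebraic trace of finite-rank endomorphisms *)

Section Trace.
Variable K : fieldType.

(** An element of the tensor product of the dual of [U] with [V], as a list of pure tensors. The
    vectors may be dependent, so sums and compositions act directly on lists. *)
Definition tensor (U V : lmodType K) (s : seq ({scalar U} * V)) (x : U) : V :=
  \sum_(p <- s) p.1 x *: p.2.

Definition tensor_trace (V : lmodType K) (s : seq ({scalar V} * V)) : K :=
  \sum_(p <- s) p.1 p.2.

(** The functionals are merely linear, so the notion makes sense on the range of an iterate without
    a topology. *)
Definition has_trace (V : lmodType K) (F : V -> V) (t : K) :=
  exists2 s, F =1 tensor s & t = tensor_trace s.

(** The functional [f - a g], kept transparent so that its values reduce. *)
Definition functional_shift (V : lmodType K) (f g : {scalar V}) (a : K) :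
  {scalar V}.
Proof.
apply: (@scalar_of _ _ (fun x => f x - a * g x)).
move=> b x y; rewrite !linearP /= mulrBr mulrDr opprD addrACA.
by rewrite !mulrA [a * b]mulrC.
Defined.

(* If [f x != 0] for the first pair [(f, v)], the relation at [x] expresses [v]
   through the other vectors, and substituting it preserves the trace. *)
Lemma tensor_trace0 (V : lmodType K) (s : seq ({scalar V} * V)) :
  (forall x, tensor s x = 0) -> tensor_trace s = 0.
Proof.
have [n] := ubnP (size s); elim: n s => // n IHn [|[f v] s] /=.
  by move=> _ _; rewrite /tensor_trace big_nil.
rewrite ltnS => le_s s0.
have {}s0 x : f x *: v = - tensor s x.
  by apply/eqP; rewrite -addr_eq0 -(s0 x) /tensor big_cons.
rewrite /tensor_trace big_cons /=.
have [f0|/existsNP[x /eqP fx]] := pselect (forall x, f x = 0).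
  rewrite f0 add0r; apply: IHn => // x; apply/eqP.
  by rewrite -oppr_eq0 -s0 f0 scale0r.
pose s' := [seq (functional_shift p.1 f ((f x)^-1 * p.1 x), p.2) | p <- s].
have vE : v = - \sum_(p <- s) ((f x)^-1 * p.1 x) *: p.2.
  rewrite -[LHS]scale1r -(mulVf fx) -scalerA s0 scalerN scaler_sumr.
  by congr (- _); apply: eq_bigr => p _; rewrite scalerA.
rewrite -[RHS](IHn s') ?size_map // /tensor_trace ?big_map.
  rewrite {1}vE linearN linear_sum /= addrC -sumrB.
  by apply: eq_bigr => p _; rewrite linearZ.
move=> y; rewrite /tensor big_map /=.
under eq_bigr do rewrite scalerBl mulrC -scalerA.
rewrite sumrB -scaler_sumr -[X in X - _]opprK -s0 vE -/(tensor s y).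
by rewrite scalerN opprK subrr.
Qed.

Lemma tensor_cat (U V : lmodType K) (s1 s2 : seq ({scalar U} * V)) x :
  tensor (s1 ++ s2) x = tensor s1 x + tensor s2 x.
Proof. exact: big_cat. Qed.

Definition tensor_opp (U V : lmodType K) (s : seq ({scalar U} * V)) :=
  [seq (p.1, - p.2) | p <- s].

Lemma tensor_oppE (U V : lmodType K) (s : seq ({scalar U} * V)) x :
  tensor (tensor_opp s) x = - tensor s x.
Proof.
by rewrite /tensor big_map -sumrN; apply: eq_bigr => p _; rewrite scalerN.
Qed.

Lemma tensor_trace_opp (V : lmodType K) (s : seq ({scalar V} * V)) :
  tensor_trace (tensor_opp s) = - tensor_trace s.
Proof.
by rewrite /tensor_trace big_map -sumrN; apply: eq_bigr => p _; rewrite linearN.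
Qed.

Lemma has_trace_ext (V : lmodType K) (F G : V -> V) t :
  F =1 G -> has_trace F t -> has_trace G t.
Proof. by move=> FG [s Fs ->]; exists s => // x; rewrite -FG. Qed.

Lemma has_traceB (V : lmodType K) (F G : V -> V) t u :
  has_trace F t -> has_trace G u -> has_trace (fun x => F x - G x) (t - u).
Proof.
move=> [s Fs ->] [s' Gs' ->]; exists (s ++ tensor_opp s').
  by move=> x; rewrite tensor_cat tensor_oppE -Fs -Gs'.
by rewrite -tensor_trace_opp /tensor_trace big_cat.
Qed.

Lemma has_traceD (V : lmodType K) (F G : V -> V) t u :
  has_trace F t -> has_trace G u -> has_trace (fun x => F x + G x) (t + u).
Proof.
move=> [s Fs ->] [s' Gs' ->]; exists (s ++ s').
  by move=> x; rewrite tensor_cat -Fs -Gs'.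
by rewrite /tensor_trace big_cat.
Qed.

(** The difference of two representations of [F] represents zero, so its trace vanishes. *)
Lemma has_trace_uniq (V : lmodType K) (F : V -> V) t u :
  has_trace F t -> has_trace F u -> t = u.
Proof.
move=> Ft Fu; have [s s0 tu] := has_traceB Ft Fu.
apply/eqP; rewrite -subr_eq0 tu tensor_trace0 // => x.
by rewrite -s0 subrr.
Qed.

Lemma fin_rank_tensor (U V : lmodType K) (F : {linear U -> V}) :
  fin_rank F -> exists s, F =1 tensor s.
Proof.
move=> /fin_rank_basis[n [z [phi [_ FE]]]].
exists [seq (phi i, F (z i)) | i <- index_enum 'I_n] => x.
by rewrite /tensor big_map.
Qed.

Lemma has_trace_sum (V : lmodType K) n (phi : 'I_n -> {scalar V}) (v : 'I_n -> V) :
  has_trace (fun x => \sum_i phi i x *: v i) (\sum_i phi i (v i)).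
Proof.
exists [seq (phi i, v i) | i <- index_enum 'I_n].
  by move=> x; rewrite /tensor big_map.
by rewrite /tensor_trace big_map.
Qed.

(** If [F] is the sum of the tensors of [f] and [v], both composites have trace the sum of the
    [f (B v)]. *)
Lemma has_trace_comm (U V : lmodType K) (F : {linear U -> V})
    (B : {linear V -> U}) :
  fin_rank F -> exists2 t,
    has_trace (fun x => F (B x)) t & has_trace (fun x => B (F x)) t.
Proof.
move=> /fin_rank_tensor[s Fs].
exists (\sum_(p <- s) p.1 (B p.2)).
  exists [seq ((p : {scalar U} * V).1 \o B : {scalar V}, p.2) | p <- s].
    by move=> x; rewrite Fs /tensor big_map.
  by rewrite /tensor_trace big_map.
exists [seq (p.1, B p.2) | p <- s].
  move=> x; rewrite Fs /tensor big_map linear_sum.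
  by apply: eq_bigr => p _; rewrite linearZ.
by rewrite /tensor_trace big_map.
Qed.

End Trace.

(** * The index of a linear Fredholm map as the trace of a commutator *)

Section Index.
Variables (K : fieldType) (V : lmodType K) (A U : {linear V -> V}).
Variables (a b : nat) (w : 'I_a -> V) (y : 'I_b -> V).
Hypothesis w_free : forall c : 'I_a -> K, \sum_i c i *: w i = 0 -> forall i, c i = 0.
Hypothesis Aw : forall i, A (w i) = 0.
Hypothesis w_span : forall x, A x = 0 -> exists c : 'I_a -> K, x = \sum_i c i *: w i.
Hypothesis y_free : forall (c : 'I_b -> K) z, \sum_i c i *: y i = A z -> forall i, c i = 0.
Hypothesis y_span : forall x, exists (c : 'I_b -> K) z, x = A z + \sum_i c i *: y i.

Let delta n (i k : 'I_n) : K := (k == i)%:R.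

Lemma sum_delta n (v : 'I_n -> V) i : \sum_k delta i k *: v k = v i.
Proof.
rewrite (bigD1 i) //= /delta eqxx scale1r big1 ?addr0 // => k /negPf ->.
by rewrite scale0r.
Qed.

(* If [1 - A U] has finite rank and [q] projects onto the span of [y] along the
   range of [A], then [1 - A U - q = A H] with [H] of finite rank; then
   [A (U + H) = 1 - q], and [1 - (U + H) A] projects onto the kernel of [A]. *)
Lemma index_trace :
  fin_rank (fun x => x - A (U x)) ->
  has_trace (fun x => A (U x) - U (A x)) (a%:R - b%:R).
Proof.
move=> GF.
pose im x := exists z, x = A z.
have imP c x z : im x -> im z -> im (c *: x + z).
  by move=> [x' ->] [z' ->]; exists (c *: x' + z'); rewrite linearP.
have [||psi [q_im psiE]] := @coordinates _ _ _ (idfun : {linear V -> V}) im b y imP.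
- by move=> c [z cz]; apply: y_free cz.
- move=> x; have [c [z ->]] := y_span x.
  by exists c, z; rewrite /= addrK.
pose q x := \sum_i psi i x *: y i.
have q_lin : linear q.
  move=> c x z; rewrite /q scaler_sumr -big_split /=; apply: eq_bigr => i _.
  by rewrite linearP scalerDl scalerA.
have psiA x i : psi i (A x) = 0.
  apply/esym; apply: (psiE _ (fun _ => 0)); exists x.
  by rewrite big1 ?subr0 // => k _; rewrite scale0r.
have psiy i k : psi k (y i) = delta i k.
  apply/esym; apply: psiE; exists 0.
  by rewrite sum_delta subrr linear0.
have tr_q : has_trace q b%:R.
  have := has_trace_sum psi y; rewrite (eq_bigr (fun=> 1)).
    by rewrite sumr_const card_ord.
  by move=> i _; rewrite psiy /delta eqxx.
pose G' : {linear V -> V} := (idfun \- (A \o U)) \- linear_of q_lin.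
have G'F : fin_rank G'.
  apply: fin_rankB => //; exists b, y => x; exists (psi ^~ x) => //.
have [n [z [phi [_ G'E]]]] := fin_rank_basis G'F.
(* [1 - q] takes its values in the range of [A], hence so does [G' = (1 - q) - A U]. *)
have /choice[h hE] : forall i, exists h, G' (z i) = A h.
  move=> i; have [h hE] := q_im (z i); exists (h - U (z i)).
  by rewrite linearB -hE /= addrAC.
pose H x := \sum_i phi i x *: h i.
have H_lin : linear H.
  move=> c x x'; rewrite /H scaler_sumr -big_split /=; apply: eq_bigr => i _.
  by rewrite linearP scalerDl scalerA.
have AH x : A (H x) = x - A (U x) - q x.
  rewrite -[RHS]/(G' x) G'E linear_sum; apply: eq_bigr => i _.
  by rewrite linearZ hE.
have HF : fin_rank (linear_of H_lin) by exists n, h => x; exists (phi ^~ x).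
pose P x := x - U (A x) - H (A x).
have AP x : A (P x) = 0.
  rewrite /P !linearB AH /= [q _]big1 ?subr0 ?subrr //.
  by move=> i _; rewrite psiA scale0r.
pose PL : {linear V -> V} := (idfun \- (U \o A)) \- (linear_of H_lin \o A).
have [|//||chi [PE chiE]] := @coordinates _ _ _ PL (fun x => x = 0) a w.
- by move=> c x x' -> ->; rewrite scaler0 addr0.
- by move=> x; have [c cE] := w_span (AP x); exists c; rewrite -cE subrr.
have chiw i k : chi k (w i) = delta i k.
  apply/esym; apply: chiE.
  by rewrite sum_delta /= Aw linear0 [H 0](linear0 (linear_of H_lin)) !subr0 subrr.
have tr_P : has_trace P a%:R.
  have := has_trace_sum chi w; rewrite (eq_bigr (fun=> 1)); last first.
    by move=> i _; rewrite chiw /delta eqxx.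
  rewrite sumr_const card_ord; apply: has_trace_ext => x.
  by apply/eqP; rewrite eq_sym -subr_eq0 PE.
(* Since [P + H A = 1 - U A] and [q + A H = 1 - A U], the commutator is [(P + H A) - (q + A H)]; the
   traces of [H A] and [A H] cancel. *)
have [t tr_HA tr_AH] := has_trace_comm A HF.
have := has_traceB (has_traceD tr_P tr_HA) (has_traceD tr_q tr_AH).
rewrite opprD addrACA subrr addr0; apply: has_trace_ext => x.
rewrite /= AH /P subrK [q x + _]addrC subrK opprB addrC addrA subrK.
by [].
Qed.

End Index.

(** * Reduction of the commutator to the range of an iterate *)

Section DrazinIndex.
Variables (K : fieldType) (X Y : lmodType K) (T S : {linear X -> X}).
Variables (A : {linear Y -> Y}) (p : {linear X -> Y}) (j : {linear Y -> X}).
Variables (n k : nat).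
Hypothesis j_inj : injective j.
Hypothesis p_surj : forall y, exists x, p x = y.
Hypothesis jp : forall x, j (p x) = iter n T x.
Hypothesis pj : forall y, p (j y) = iter n A y.
Hypothesis jA : forall y, j (A y) = T (j y).
Hypothesis TS : fin_rank (fun x => T (S x) - S (T x)).
Hypothesis STS : fin_rank (fun x => S (T (S x)) - S x).
Hypothesis TkST : fin_rank (fun x => iter k T (S (T x)) - iter k T x).

(** Equality of classes modulo finite rank, on bare functions so that no linear structure has to be
    packed. *)
Let eqm (F G : X -> X) := fin_rank (fun x => F x - G x).

Lemma eqm_trans F G H : eqm F G -> eqm G H -> eqm F H.
Proof.
move=> FG GH; apply: fin_rank_ext (fin_rankD FG GH) => x.
by rewrite addrA subrK.
Qed.

Lemma eqm_refl F : eqm F F.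
Proof. by exists 0%N, (fun _ => 0) => x; exists (fun _ => 0); rewrite subrr big_ord0. Qed.

Lemma eqm_sym F G : eqm F G -> eqm G F.
Proof. by move/fin_rankN; apply: fin_rank_ext => x; rewrite opprB. Qed.

Lemma eqm_compl (B : {linear X -> X}) F G :
  eqm F G -> eqm (fun x => B (F x)) (fun x => B (G x)).
Proof. by move/(fin_rank_compl B); apply: fin_rank_ext => x; rewrite linearB. Qed.

Lemma eqm_compr (g : X -> X) F G :
  eqm F G -> eqm (fun x => F (g x)) (fun x => G (g x)).
Proof. exact: fin_rank_compr. Qed.

(** Modulo finite rank [T S S = S T S = S], so each factor [T] absorbs one factor [S]. *)
Lemma iterT_S m : eqm (fun x => iter m T (iter m.+1 S x)) S.
Proof.
have TSS : eqm (fun x => T (S (S x))) S.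
  exact: eqm_trans (eqm_compr S TS) STS.
elim: m => [|m IHm]; first exact: eqm_refl.
apply: eqm_trans IHm.
have := eqm_compl (iter m T) (eqm_compr (iter m S) TSS).
rewrite /eqm; apply: fin_rank_ext => x.
by rewrite /= -!iterSr.
Qed.

Lemma iterS_T m l : eqm (fun x => iter (m + l).+1 S (iter m T x)) (iter l.+1 S).
Proof.
have SST : eqm (fun x => S (S (T x))) S.
  apply: eqm_trans STS; apply: eqm_sym; exact: (eqm_compl S TS).
elim: m => [|m IHm]; first exact: eqm_refl.
apply: eqm_trans IHm.
have := eqm_compl (iter (m + l) S) (eqm_compr (iter m T) SST).
rewrite /eqm; apply: fin_rank_ext => x.
by rewrite addSn /= -!iterSr.
Qed.

(** Of the [2n + 1] factors [S], each outer [T^n] absorbs [n], and one is left. *)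
Lemma drazin_sandwich : eqm (fun x => iter n T (iter n.*2.+1 S (iter n T x))) S.
Proof.
apply: eqm_trans (iterT_S n); rewrite -addnn.
exact: (eqm_compl (iter n T) (iterS_T n n)).
Qed.

(** Modulo finite rank [T^(k+1) S = T^k S T = T^k]; this removes the pairs of [T] and [S] one at a
    time. *)
Lemma iterT_iterS m : eqm (fun x => iter (k + m) T (iter m S x)) (iter k T).
Proof.
have TkTS : eqm (fun x => iter k.+1 T (S x)) (iter k T).
  apply: eqm_trans TkST; have := eqm_compl (iter k T) TS.
  by rewrite /eqm; apply: fin_rank_ext => x; rewrite iterSr.
elim: m => [|m IHm]; first by rewrite addn0; apply: eqm_refl.
apply: eqm_trans IHm.
have := eqm_compl (iter m T) (eqm_compr (iter m S) TkTS).
by rewrite /eqm; apply: fin_rank_ext => x; rewrite addnS [(k + m)%N]addnC /= !iterD -iterSr.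
Qed.

Lemma j_iter m y : j (iter m A y) = iter m T (j y).
Proof. by elim: m => //= m IHm; rewrite jA IHm. Qed.

(** As [p] is onto, [j C p] and [j C] have the same values; [j] then cancels, its kernel being
    spanned by the empty family. *)
Lemma fin_rank_restrict (C : {linear Y -> Y}) :
  fin_rank (fun x => j (C (p x))) -> fin_rank C.
Proof.
move=> [m [v jCp]].
apply: (@fin_rank_cancel _ _ _ _ j C 0 (fun _ => 0)) => [[]//||].
  by move=> x jx; exists (fun _ => 0); rewrite big_ord0; apply: j_inj; rewrite jx linear0.
by exists m, v => y; have [x <-] := p_surj y.
Qed.

Lemma fin_rank_cancel_iter (C : {linear Y -> Y}) a (w : 'I_a -> Y) m :
  (forall i, A (w i) = 0) ->
  (forall x, A x = 0 -> exists c : 'I_a -> K, x = \sum_i c i *: w i) ->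
  fin_rank (fun x => iter m A (C x)) -> fin_rank C.
Proof.
move=> Aw w_span; elim: m => // m IHm AmC; apply: IHm.
exact: (@fin_rank_cancel _ _ _ _ A (iter m A \o C) a w).
Qed.

Lemma drazin_index_trace a b (w : 'I_a -> Y) (y : 'I_b -> Y) :
  (forall c : 'I_a -> K, \sum_i c i *: w i = 0 -> forall i, c i = 0) ->
  (forall i, A (w i) = 0) ->
  (forall x, A x = 0 -> exists c : 'I_a -> K, x = \sum_i c i *: w i) ->
  (forall (c : 'I_b -> K) z, \sum_i c i *: y i = A z -> forall i, c i = 0) ->
  (forall x, exists (c : 'I_b -> K) z, x = A z + \sum_i c i *: y i) ->
  has_trace (fun x => T (S x) - S (T x)) (a%:R - b%:R).
Proof.
move=> w_free Aw w_span y_free y_span.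
pose W := p \o iter n.*2.+1 S \o j : {linear Y -> Y}.
pose S0 := j \o W \o p : {linear X -> X}.
have S0S : eqm S0 S.
  apply: eqm_trans drazin_sandwich.
  apply: fin_rank_ext (eqm_refl S0) => x.
  by rewrite /S0 /W /= !jp.
pose E := S \- S0 : {linear X -> X}.
have EF : fin_rank E by apply: eqm_sym.
(* [S0] agrees with [S] modulo finite rank, so it inherits commutation with [T]. *)
have TS0 : eqm (T \o S0) (S0 \o T).
  apply: eqm_trans (eqm_compl T S0S) _; apply: eqm_trans TS _.
  exact: eqm_sym (eqm_compr T S0S).
pose C := (A \o W) \- (W \o A) : {linear Y -> Y}.
have pT x : p (T x) = A (p x).
  by apply: j_inj; rewrite jA !jp -iterSr.
have CF : fin_rank C.
  apply: fin_rank_restrict; apply: fin_rank_ext TS0 => x.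
  by rewrite /C /S0 /= linearB jA pT.
have [t tr_jCp tr_Cpj] := has_trace_comm p (fin_rank_compl j CF : fin_rank (j \o C)).
pose U := iter n A \o W : {linear Y -> Y}.
(* [j A^k (1 - A U) p] equals [(T^k - T^(k+2n+1) S^(2n+1)) T^n], of finite rank. Then [j] and [p]
   are removed, and [A^k] cancels because the kernel of [A] has finite dimension. *)
have UF : fin_rank (fun x => x - A (U x)).
  apply: (@fin_rank_cancel_iter (idfun \- (A \o U)) _ w k) => //.
  apply: (@fin_rank_restrict (iter k A \o (idfun \- (A \o U)))).
  have := eqm_sym (eqm_compr (iter n T) (iterT_iterS n.*2.+1)).
  apply: fin_rank_ext => x /=.
  rewrite !linearB /= -jp; congr (_ - _); first by rewrite j_iter.
  rewrite j_iter jA j_iter /W /= jp.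
  by rewrite jp -addnn addnS /= !iterD -iterSr.
have tr_U := index_trace w_free Aw w_span y_free y_span UF.
have {tr_U} t_ab : t = a%:R - b%:R.
  apply: has_trace_uniq tr_U; apply: has_trace_ext tr_Cpj => x.
  by rewrite pj /U /= linearB /=; congr (_ - _); rewrite -[RHS]iterS iterSr.
(* [[T, S] = [T, S0] + [T, E]], and the last commutator has trace zero because [E] has finite
   rank. *)
have [u tr_ET tr_TE] := has_trace_comm T EF.
have := has_traceD tr_jCp (has_traceB tr_TE tr_ET).
rewrite subrr addr0 t_ab; apply: has_trace_ext => x.
rewrite /E /C /S0 /= !linearB /= jA pT.
by rewrite opprK [X in _ + (_ + X)]addrC addrCA !addrA !subrK.
Qed.

End DrazinIndex.

(** * Boundedness of the coefficients over a free family *)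

Section CoefficientBound.
Variables (R : realType) (X : normedModType R[i]) (n : nat) (v : 'I_n -> X).
Hypothesis v_free :
  forall c : 'I_n -> R[i], \sum_i c i *: v i = 0 -> forall i, c i = 0.

(** Complex coefficients are stored as a real row, real parts first, because the compactness
    argument runs over real row vectors. *)
Let cplx (r : 'rV[R]_(n + n)) i : R[i] :=
  Complex (r 0 (lshift n i)) (r 0 (rshift n i)).

Let L (r : 'rV[R]_(n + n)) : X := \sum_i cplx r i *: v i.

(** The norm of [X] is valued in [R[i]]; its real part gives a real function to minimize. *)
Let f r : R := complex.Re `|L r|.

Let LB r s : L (r - s) = L r - L s.
Proof.
rewrite /L -sumrB; apply: eq_bigr => i _.
by rewrite -scalerBl /cplx !mxE.
Qed.

Let LZ (a : R) r : L (a *: r) = real_complex R a *: L r.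
Proof.
rewrite /L scaler_sumr; apply: eq_bigr => i _; rewrite scalerA /cplx !mxE.
by congr (_ *: _); rewrite /GRing.mul /= !mul0r subr0 addr0.
Qed.

Lemma real_normE (x : X) : `|x| = real_complex R (complex.Re `|x|).
Proof. by rewrite RRe_real // ger0_real. Qed.

Let entry_le (r : 'rV[R]_(n + n)) i : `|r 0 i| <= `|r|.
Proof.
rewrite [leRHS]/Num.norm /= mx_normrE.
exact: (le_bigmax _ (fun ij : 'I_1 * 'I_(n + n) => `|r ij.1 ij.2|) (0, i)).
Qed.

Let cplx_le r i : `|cplx r i| <= real_complex R (2 * `|r|).
Proof.
have -> : cplx r i = real_complex R (r 0 (lshift n i)) +
    'i%C * real_complex R (r 0 (rshift n i)).
  by rewrite [LHS]complexE.
apply: le_trans (ler_normD _ _) _.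
rewrite normrM [`|'i%C|]normc_def /= expr0n expr1n add0r sqrtr1 mul1r mulr_natl mulr2n rmorphD /=.
by apply: lerD; rewrite normc_def /= expr0n addr0 sqrtr_sqr lecR.
Qed.

Let fZ (a : R) r : f (a *: r) = `|a| * f r.
Proof.
apply: complexI; rewrite rmorphM /= /f -!real_normE LZ normrZ.
by rewrite normc_def /= expr0n addr0 sqrtr_sqr.
Qed.

Let f_le : exists2 C, 0 < C & forall r, f r <= C * `|r|.
Proof.
have sumE : \sum_i `|v i| = real_complex R (\sum_i complex.Re `|v i|).
  by rewrite rmorph_sum; apply: eq_bigr => i _; apply: real_normE.
have sum_ge0 : 0 <= \sum_i complex.Re `|v i|.
  by apply: sumr_ge0 => i _; rewrite -ler0c -real_normE.
(* The factor 2 accounts for real and imaginary parts; the added 1 keeps the constant positive when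
   the sum is zero. *)
exists (2 * \sum_i complex.Re `|v i| + 1).
  by rewrite ltr_wpDl // mulr_ge0.
move=> r; rewrite -lecR /f -real_normE.
apply: le_trans (ler_norm_sum _ _ _) _.
apply: (@le_trans _ _ (\sum_i real_complex R (2 * `|r|) * `|v i|)).
  by apply: ler_sum => i _; rewrite normrZ ler_wpM2r.
rewrite -mulr_sumr sumE -rmorphM lecR mulrAC ler_wpM2r //.
by rewrite lerDl.
Qed.

Let f_lip r s : `|f r - f s| <= f (r - s).
Proof.
have fs t u : f t <= f (t - u) + f u.
  rewrite -lecR rmorphD /= /f -!real_normE.
  by have := ler_normD (L (t - u)) (L u); rewrite {1}LB subrK.
have fC : f (s - r) = f (r - s).
  by rewrite -[s - r]opprB -scaleN1r fZ normrN1 mul1r.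
by rewrite ler_norml lerBlDr fs lerNl opprB lerBlDr -fC fs.
Qed.

Let f_cont : continuous f.
Proof.
have [C C_gt0 fC] := f_le.
move=> r; apply/(@cvgrPdist_lt _ _ _ (nbhs r) (nbhs_filter r)) => e e_gt0.
have Ce_gt0 : 0 < C^-1 * e by rewrite mulr_gt0 // invr_gt0.
apply/(@nbhs_normP R 'rV[R]_(n + n)); exists (C^-1 * e) => //= s rs.
apply: le_lt_trans (f_lip _ _) _; apply: le_lt_trans (fC _) _.
by rewrite -ltr_pdivlMl.
Qed.

(* Compactness of the real unit sphere of dimension [2 n]. *)
Lemma free_coef_bound : exists2 M : R[i], 0 <= M & forall (c : 'I_n -> R[i]) i,
  `|c i| <= M * `|\sum_k c k *: v k|.
Proof.
pose S := [set r : 'rV[R]_(n + n) | `|r| = 1]%classic.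
have S_compact : compact S.
  apply: bounded_closed_compact.
    by exists 1; split => // y y_gt1 r /= ->; apply: ltW.
  apply: (@closed_comp _ _ (fun r : 'rV[R]_(n + n) => `|r|) [set x | x = 1]%classic).
    by move=> r _; apply: norm_continuous.
  exact: closed_eq.
have [m m_gt0 mP] : exists2 m, 0 < m & forall r, S r -> m <= f r.
  (* The sphere is empty when [n = 0], and any positive [m] then serves. *)
  have [S0|/set0P S0] := eqVneq S set0.
    by exists 1 => // r; rewrite S0.
  have [r Sr rmin] := EVT_min_rV S0 S_compact (continuous_subspaceT f_cont).
  exists (f r); last by move=> s Ss; apply: rmin; rewrite inE.
  have fr : 0 <= f r by rewrite -ler0c /f -real_normE.
  rewrite lt_neqAle fr andbT eq_sym; apply/eqP => fr0.
  have Lr0 : L r = 0 by apply/eqP; rewrite -normr_eq0 real_normE -/(f r) fr0.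
  have cr0 := v_free Lr0.
  move: Sr; rewrite inE /S /=.
  suff -> : r = 0 by rewrite normr0 => /esym/eqP; rewrite oner_eq0.
  apply/rowP => i; rewrite mxE.
  case: (splitP i) => k ik; have [re0 im0] := cr0 k.
    by rewrite -[RHS]re0; congr (r _ _); apply: val_inj.
  by rewrite -[RHS]im0; congr (r _ _); apply: val_inj.
have fm r : m * `|r| <= f r.
  have [->|r0] := eqVneq r 0; first by rewrite normr0 mulr0 -ler0c /f -real_normE.
  have nr : 0 < `|r| by rewrite normr_gt0.
  have := mP (`|r|^-1 *: r); rewrite fZ ger0_norm ?invr_ge0 // ler_pdivlMl //.
  by rewrite mulrC; apply; rewrite /S /= normrZ ger0_norm ?invr_ge0 // mulVf ?gt_eqF.
(* A coefficient is at most twice the norm of its real row [r], and that norm is at most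
   [f r / m]. *)
exists (real_complex R (2 / m)) => [|c i].
  by rewrite ler0c divr_ge0 // ltW.
pose r : 'rV[R]_(n + n) := row_mx (\row_k complex.Re (c k)) (\row_k complex.Im (c k)).
have cr : cplx r =1 c.
  by move=> k; rewrite /cplx row_mxEl row_mxEr !mxE; case: (c k).
have -> : \sum_k c k *: v k = L r by apply: eq_bigr => k _; rewrite cr.
rewrite -cr (le_trans (cplx_le r i)) // real_normE -rmorphM /= lecR.
by rewrite -mulrA ler_pM2l // ler_pdivlMl // fm.
Qed.

End CoefficientBound.

(** * The range of a linear map as a vector space *)

Section RangeType.
Variables (K : fieldType) (U V : lmodType K) (f : {linear U -> V}).

Definition in_range : pred V := fun y => `[< exists x, f x = y >].

Lemma in_range_submod : submod_closed in_range.
Proof.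
split; first by apply/asboolP; exists 0; rewrite linear0.
move=> a _ _ /asboolP[x <-] /asboolP[y <-].
by apply/asboolP; exists (a *: x + y); rewrite linearP.
Qed.

HB.instance Definition _ := GRing.isSubmodClosed.Build K V in_range in_range_submod.

Record range_type := RangeType { range_val :> V; _ : range_val \in in_range }.
HB.instance Definition _ := [isSub for range_val].
HB.instance Definition _ := [Choice of range_type by <:].
HB.instance Definition _ := [SubChoice_isSubLmodule of range_type by <:].

Lemma range_valP (y : range_type) : exists x, f x = range_val y.
Proof. by case: y => y /= /asboolP. Qed.

Lemma range_val_surj x : exists y : range_type, range_val y = f x.
Proof.
have fx : f x \in in_range by apply/asboolP; exists x.
by exists (RangeType fx).
Qed.

(** Preimages under the injective [range_val] are unique, so the chosen lift is linear. Both the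
    corestriction and the restriction to the range arise this way. *)
Lemma range_lift (W : lmodType K) (g : {linear W -> V}) :
  (forall x, exists y, f y = g x) ->
  exists h : {linear W -> range_type}, forall x, range_val (h x) = g x.
Proof.
move=> gf; have /choice[h hE] : forall x, exists y : range_type, range_val y = g x.
  by move=> x; have [y <-] := gf x; apply: range_val_surj.
have h_lin : linear h.
  move=> a x y; apply: val_inj.
  by rewrite linearP /= !hE linearP.
by exists (linear_of h_lin).
Qed.

End RangeType.

(** * Transfer to bounded operators on a Banach space *)

Section BFredholmTrace.
Variables (R : realType) (X : completeNormedModType R[i]).

(** A nonzero [x] forces [0 <= M]. If [M] is not nonnegative, the space is therefore zero and the
    bound 0 works. *)
Lemma bounded_op_ge0 (f : X -> X) :
  bounded_op f -> exists2 M : R[i], 0 <= M & forall x, `|f x| <= M * `|x|.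
Proof.
move=> [f_lin [M fM]]; have [M_ge0|M_lt0] := boolP (0 <= M); first by exists M.
exists 0 => // x; have [->|x_neq0] := eqVneq x 0.
  by rewrite normr0 mulr0 normr_le0; apply/eqP; apply: (linear0 (linear_of f_lin)).
move: M_lt0; rewrite -(pmulr_lge0 _ (_ : 0 < `|x|)) ?normr_gt0 //.
by rewrite (le_trans _ (fM x)).
Qed.

Lemma bounded_op_commutator (T S : X -> X) : bounded_op T -> bounded_op S ->
  bounded_op (fun x => T (S x) - S (T x)).
Proof.
move=> bT bS; have [M M0 TM] := bounded_op_ge0 bT.
have [N N0 SN] := bounded_op_ge0 bS; have [T_lin _] := bT; have [S_lin _] := bS.
split.
  move=> a x y; rewrite !(S_lin, T_lin) scalerBr opprD.
  by rewrite addrACA.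
exists (M * N + N * M) => x; rewrite mulrDl -!mulrA.
apply: le_trans (ler_normB _ _) _; apply: lerD.
  by rewrite (le_trans (TM _)) // ler_wpM2l.
by rewrite (le_trans (SN _)) // ler_wpM2l.
Qed.

Lemma cont_functionalP (phi : {scalar X}) (M : R[i]) :
  0 <= M -> (forall x, `|phi x| <= M * `|x|) -> cont_functional phi.
Proof.
move=> M0 phiM; split; first by move=> a x y; rewrite linearP.
have phi_lin : linear (phi : X -> R[i]^o) by move=> a x y; rewrite linearP.
apply: (@bounded_linear_continuous R[i] X R[i]^o (linear_of phi_lin)).
apply/bounded_funP => r; exists (M * r) => x xr.
by apply: le_trans (phiM x) _; rewrite ler_wpM2l.
Qed.

(** Forgetting continuity and the basis condition makes the algebraic uniqueness of the trace
    available. *)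
Lemma has_trace_trace_rep (F : X -> X) t : trace_rep F t -> has_trace F t.
Proof.
move=> [n [v [phi [_ [_ [_ [phi_cont [FE ->]]]]]]]].
have phi_lin i : scalar (phi i) by case: (phi_cont i).
apply: has_trace_ext (has_trace_sum (fun i => scalar_of (phi_lin i)) v) => x.
by rewrite FE.
Qed.

(** The coordinates of [F x] in a basis of the range are bounded by a multiple of the norm of [F x],
    hence of [x], so they are continuous functionals. *)
Lemma trace_rep_ex (F : X -> X) :
  bounded_op F -> finite_rank F -> exists t, trace_rep F t.
Proof.
move=> bF F_fin; have [F_lin _] := bF; have [M M0 FM] := bounded_op_ge0 bF.
have [n [z [phi [z_free FE]]]] := @fin_rank_basis _ _ _ (linear_of F_lin) F_fin.
have [C C0 phiC] := free_coef_bound z_free.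
exists (\sum_i phi i (F (z i))), n, (fun i => F (z i)), phi.
split.
  exists (fun i => F (z i)); split; first by move=> i; exists (z i).
  split; first exact: z_free.
  by move=> _ [x _ <-]; exists (phi ^~ x); apply: FE.
split; first by move=> i; exists (z i).
split; first exact: z_free.
split; last by [].
move=> i; apply: (@cont_functionalP _ (C * M)); first exact: mulr_ge0.
move=> x; apply: le_trans (phiC (phi ^~ x) i) _.
by rewrite -mulrA ler_wpM2l // (le_trans _ (FM x)) // -(FE x).
Qed.

Lemma has_trace_trace (F : X -> X) t :
  bounded_op F -> finite_rank F -> has_trace F t -> trace F = t.
Proof.
move=> bF F_fin Ft; rewrite /trace; case: pselect => [ex_t|]; last first.
  by case; apply: trace_rep_ex.
by case: cid => u /= /has_trace_trace_rep Fu; apply: has_trace_uniq Fu Ft.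
Qed.

(** The bases of the kernel and of the quotient are vectors of [X] lying in the range of [T^n];
    lifting them through the injective [j] gives the data for [drazin_index_trace]. *)
Lemma BFredholm_at_trace (T S : X -> X) n i :
  linear_op T -> linear_op S -> drazin_mod_finrank T S -> BFredholm_at T n i ->
  has_trace (fun x => T (S x) - S (T x)) (i%:~R : R[i]).
Proof.
move=> T_lin S_lin [TS [STS [k [_ TkST]]]].
move=> [_ [a [b [[w [wP [w_free w_span]]] [_ [[y [yP [y_free y_span]]] ->]]]]]].
pose TL := linear_of T_lin; pose SL := linear_of S_lin.
pose Tn : {linear X -> X} := iter n TL.
pose Y : lmodType R[i] := range_type Tn; pose j : {linear Y -> X} := val.
have j_inj : injective j := val_inj.
have j_ex x : rangeP T n x -> exists u : Y, j u = x.
  by move=> [x' _ <-]; apply: range_val_surj.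
have jP (u : Y) : rangeP T n (j u).
  by have [x' xE] := range_valP u; exists x'.
have [p jp] := @range_lift _ _ _ Tn _ Tn (fun x => ex_intro _ x erefl).
have [|A jA] := @range_lift _ _ _ Tn _ (TL \o j).
  move=> u; have [x' xE] := range_valP u; exists (T x').
  exact: etrans (esym (iterSr n T x')) (congr1 T xE).
have p_surj u : exists x, p x = u.
  have [x' xE] := range_valP u; exists x'.
  exact/j_inj/(etrans (jp x') xE).
have j_iter m u : j (iter m A u) = iter m T (j u).
  by elim: m => //= m IHm; rewrite [LHS]jA /= IHm.
have pj u : p (j u) = iter n A u.
  by apply: j_inj; rewrite j_iter; apply: jp.
have /choice[w' w'E] : forall l, exists u, j u = w l.
  by move=> l; apply: j_ex; have [] := wP l.
have /choice[y' y'E] : forall l, exists u, j u = y l.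
  by move=> l; apply: j_ex; apply: yP.
have j_sum m (c : 'I_m -> R[i]) (v : 'I_m -> Y) (v' : 'I_m -> X) :
    (forall l, j (v l) = v' l) -> j (\sum_l c l *: v l) = lin_comb c v'.
  by move=> vE; rewrite linear_sum; apply: eq_bigr => l _; rewrite linearZ vE.
rewrite intrB.
apply: (@drazin_index_trace _ _ _ TL SL A p j n k j_inj p_surj jp pj jA TS STS
  TkST a b w' y').
- by move=> c c0; apply: w_free; rewrite -(j_sum _ _ _ _ w'E) c0 linear0.
- move=> l; apply: j_inj; rewrite linear0.
  exact: etrans (jA (w' l)) (etrans (congr1 T (w'E l)) (proj2 (wP l))).
- move=> u Au0; have [|c cE] := w_span (j u).
    split; first exact: jP.
    exact: etrans (esym (jA u)) (etrans (congr1 j Au0) (linear0 j)).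
  by exists c; apply: j_inj; rewrite (j_sum _ _ _ _ w'E).
- move=> c u cu; apply: y_free; exists (j u); first exact: jP.
  by rewrite -(j_sum _ _ _ _ y'E) cu [RHS]jA.
- move=> u; have [c [_ [[x' /j_ex[u' <-] <-] uE]]] := y_span _ (jP u).
  exists c, u'; apply: j_inj; rewrite uE linearD (j_sum _ _ _ _ y'E).
  by rewrite [j (A u')]jA.
Qed.

End BFredholmTrace.

Theorem theorem2p5 (R : realType) (X : completeNormedModType R[i])
    (T S : X -> X) :
  bounded_op T -> bounded_op S ->
  BFredholm T ->
  drazin_mod_finrank T S ->
  finite_rank (fun x => T (S x) - S (T x)) /\
  ((ind T)%:~R : R[i]) = trace (fun x => T (S x) - S (T x)).
Proof.
move=> bT bS BT TS; have [TS_fin _] := TS; split=> //.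
have [T_lin _] := bT; have [S_lin _] := bS.
apply/esym; apply: has_trace_trace => //; first exact: bounded_op_commutator.
rewrite /ind; case: pselect => [ex_i|no_i]; last first.
  by case: BT => n [i ni]; case: no_i; exists i, n.
(* The index chosen by [ind] comes with some [n], and the trace formula holds at every such [n]. *)
by case: cid => i /= [n ni]; apply: BFredholm_at_trace ni.
Qed.
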